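(* Let $C$ be a cycle of goods and $N=\{1,\dots,n\}$, $n\ge2$, a set of agents, each with a utility function on $C$. Let $$c=\max_{d\in\{n,n+1,\dots\}}\min\left(\frac{n}{d},\ \frac{n}{\lceil n^2/d\rceil+n-2}\right).$$ Then there exists a $c$-sufficient allocation of the goods of $C$ to the agents in $N$.
   Context: A cycle of goods has goods $v_1,\dots,v_m$ with edges $v_iv_{i+1}$ and $v_mv_1$. A utility function assigns a non-negative real to each good, extended additively to sets. A bundle is a set of goods inducing a connected subgraph (empty allowed); an $n$-split is a sequence of $n$ pairwise disjoint bundles (possibly empty) with union all goods. $\mathrm{mms}^{(n)}(C,u)=\max_{P_1,\dots,P_n}\min_i u(P_i)$ over all $n$-splits. An allocation to agents $1,\dots,n$ with utilities $u_1,\dots,u_n$ is an $n$-split $P_1,\dots,P_n$ with $P_i$ given to agent $i$; for $c>0$ it is $c$-sufficient if $u_i(P_i)\ge c\cdot\mathrm{mms}^{(n)}(C,u_i)$ for all $i$. *)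

(* Defs.v *)
From HB Require Import structures.
From mathcomp Require Import all_boot all_order all_algebra.
Set Implicit Arguments. Unset Strict Implicit. Unset Printing Implicit Defensive.
Import Order.TTheory GRing.Theory Num.Theory.
Local Open Scope ring_scope.

(* The cycle of goods v_1..v_m is modelled by 'I_m (v_{k+1} <-> k). *)
Definition cyc_adj (m : nat) : rel 'I_m :=
  fun i j => (val j == (val i).+1 %% m)%N || (val i == (val j).+1 %% m)%N.

Definition connected_bundle (m : nat) (B : {set 'I_m}) : bool :=
  [forall x in B, forall y in B,
     connect [rel a b | [&& a \in B, b \in B & cyc_adj a b]] x y].

Definition util (R : realFieldType) (m : nat) (u : 'I_m -> R) (B : {set 'I_m}) : R :=
  \sum_(g in B) u g.

Definition is_split (m n : nat) (P : {ffun 'I_n -> {set 'I_m}}) : bool :=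
  [&& [forall i, connected_bundle (P i)],
      [forall i, forall j, (i != j) ==> [disjoint P i & P j]] &
      \bigcup_(i < n) P i == setT].

(* min_i u(P_i); the identity element u(C) is an upper bound of every u(P_i)
   (utilities are non-negative), so for n >= 1 this is the true minimum. *)
Definition split_value (R : realFieldType) (m n : nat) (u : 'I_m -> R)
    (P : {ffun 'I_n -> {set 'I_m}}) : R :=
  \big[Order.min/util u setT]_(i < n) util u (P i).

(* mms^(n)(C,u) = max over n-splits of min_i u(P_i); the identity 0 is a lower
   bound of every split value (utilities non-negative), and an n-split always
   exists for n >= 1, so this is the true maximum. *)
Definition mms (R : realFieldType) (m n : nat) (u : 'I_m -> R) : R :=
  \big[Order.max/0]_(P : {ffun 'I_n -> {set 'I_m}} | is_split P) split_value u P.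

Definition c_sufficient (R : realFieldType) (m n : nat) (U : 'I_n -> 'I_m -> R)
    (c : R) (P : {ffun 'I_n -> {set 'I_m}}) : Prop :=
  is_split P /\ forall i : 'I_n, c * mms n (U i) <= util (U i) (P i).

Definition ceil_div (a b : nat) : nat := ((a + b).-1 %/ b)%N.

Definition cval (R : realFieldType) (n d : nat) : R :=
  Order.min (n%:R / d%:R) (n%:R / (ceil_div (n ^ 2) d + n - 2)%N%:R).

(* Main.v *)
Require Import Defs.
From HB Require Import structures.
From mathcomp Require Import all_boot all_order all_algebra.
From mathcomp Require Import zify lra.
Import Order.TTheory GRing.Theory Num.Theory.
Local Open Scope ring_scope.

(* Every agent fixes a maximin split of the cycle, which has [n] cuts; write
   [s = ceil(n^2/d)] and say that an agent likes an arc worth [c] times her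
   share.  Grouping the at most [n^2] cuts of all agents [s] by [s] splits the
   cycle into [d] arcs with fewer than [s] interior cuts each, and as
   [c <= n/d] some agent likes one of them.  Shorten it to an arc [A] of which
   nobody likes a proper initial segment, give [A] to someone who likes it, and
   share the remaining path by a moving knife.  An agent with no cut inside [A]
   still has [n-1] full bundles in that path, hence is served by the knife.
   Fewer than [s] agents are bad, i.e. have a cut inside [A]; these get
   priority.  For a bad agent, a bundle given to a good agent is worth less
   than [c] shares and a bundle given to a bad agent at most [2c] (unless some
   agent likes a single good, in which case that good can serve as [A] and
   nobody is bad).  So a bad agent who remains last has lost at most
   [n + s - 3] times [c] shares of her [n] shares, and [c <= n/(n + s - 2)]. *)

(** * Packing and cutting a path of non-negative weights *)

Section PathDivision.
Set Implicit Arguments. Unset Strict Implicit.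
Variable R : realFieldType.

Definition span_sum (w : nat -> R) (x y : nat) : R := \sum_(x <= k < y) w k.

(** Packing of [k] consecutive intervals worth at least [v] each. The recursion peels off the
    leftmost interval, as a knife moving from the left does, and goods left over at the right end
    are allowed. *)
Fixpoint fits (w : nat -> R) (v : R) (k x y : nat) : Prop :=
  if k is k'.+1 then
    exists z, [/\ (x <= z <= y)%N, v <= span_sum w x z & fits w v k' z y]
  else (x <= y)%N.

Lemma span_sum_ge0 w x y : (forall k, 0 <= w k) -> 0 <= span_sum w x y.
Proof. by move=> w0; apply: sumr_ge0. Qed.

Lemma span_sumD w x y z : (x <= y <= z)%N ->
  span_sum w x z = span_sum w x y + span_sum w y z.
Proof. by case/andP=> xy yz; rewrite /span_sum (big_cat_nat xy yz). Qed.

Lemma span_sum_id w x : span_sum w x x = 0.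
Proof. by rewrite /span_sum big_geq. Qed.

Lemma span_sumS w x y : (x <= y)%N ->
  span_sum w x y.+1 = span_sum w x y + w y.
Proof. by move=> xy; rewrite /span_sum big_nat_recr. Qed.

Lemma span_sum_mono w x x' y y' : (forall k, 0 <= w k) ->
  (x' <= x)%N -> (x <= y)%N -> (y <= y')%N ->
  span_sum w x y <= span_sum w x' y'.
Proof.
move=> w0 x'x xy yy'.
rewrite (@span_sumD w x' x y') ?(@span_sumD w x y y'); try lia.
by rewrite addrCA lerDl addr_ge0 ?span_sum_ge0.
Qed.

Lemma fits_start w v k x x' y : (forall t, 0 <= w t) -> (x' <= x)%N ->
  fits w v k x y -> fits w v k x' y.
Proof.
move=> w0 x'x; case: k => [|k] /=; first by lia.
case=> z [xzy vz fz]; exists z; split=> //; first by lia.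
by apply: le_trans vz (span_sum_mono _ _ _ _); try lia.
Qed.

Lemma fits_le w v v' k x y : v' <= v -> fits w v k x y -> fits w v' k x y.
Proof.
move=> v'v; elim: k x => //= k IH x [z [xzy vz fz]].
by exists z; split=> //; [exact: le_trans vz | exact: IH].
Qed.

Lemma fits0 w v k x y : (forall t, 0 <= w t) -> v <= 0 -> (x <= y)%N ->
  fits w v k x y.
Proof.
move=> w0 v0 xy; elim: k => //= k IH; exists x; split=> //; first by lia.
by rewrite span_sum_id.
Qed.

(** Greedy: take the longest initial interval with interior weight below [s]. If it is worth less
    than [th], extending it by one position would reach weight [s]; so the rest, from [z] on, loses
    at least [s] of weight but less than one [th] of value, and induction on [d] applies. Interior
    sums start at [x.+1] because weight at an endpoint does not count. *)
Lemma light_span (w : nat -> R) (h : nat -> nat) (s d : nat) (th : R) x y :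
  (forall k, 0 <= w k) -> (0 < s)%N -> (x <= y)%N ->
  (\sum_(x.+1 <= k < y) h k < d * s)%N -> d%:R * th <= span_sum w x y ->
  exists a b, [/\ (x <= a <= b)%N, (b <= y)%N,
    (\sum_(a.+1 <= k < b) h k < s)%N & th <= span_sum w a b].
Proof.
move=> w0 s0; elim: d x => [//|d IH] x xy hxy thxy.
pose Z z := [&& x <= z, z <= y & \sum_(x.+1 <= k < z) h k < s]%N.
have Zx : exists z, Z z by exists x; rewrite /Z leqnn xy big_geq.
have Zy z : Z z -> (z <= y)%N by case/and3P.
case: (ex_maxnP Zx Zy) => z /and3P[xz zy hz] zmax.
case: (leP th (span_sum w x z)) => [thz|zth].
  by exists x, z; split=> //; rewrite leqnn.
have th0 : 0 < th by apply: le_lt_trans zth; exact: span_sum_ge0.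
have zlty : (z < y)%N.
  rewrite ltn_neqAle zy andbT; apply/eqP => zE; move: thxy zth.
  rewrite zE -natr1 mulrDl mul1r.
  have := mulr_ge0 (ler0n R d) (ltW th0).
  lra.
have hz1 : (s <= \sum_(x.+1 <= k < z.+1) h k)%N.
  rewrite leqNgt; apply/negP => lt_s.
  have := zmax z.+1; rewrite /Z lt_s zlty ltnn; lia.
have [a [b [H1 H2 H3 H4]]] : exists a b, [/\ (z <= a <= b)%N, (b <= y)%N,
    (\sum_(a.+1 <= k < b) h k < s)%N & th <= span_sum w a b].
  apply: IH => //.
    move: hxy; rewrite (@big_cat_nat _ _ _ z.+1) //=; lia.
  move: thxy; rewrite (@span_sumD w x z y) ?xz // -natr1 mulrDl mul1r; lra.
by exists a, b; split=> //; lia.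
Qed.

End PathDivision.

(** * The moving knife with priority for bad agents *)

Section Knife.
Set Implicit Arguments. Unset Strict Implicit.
Variables (R : realFieldType) (T : finType).
Variables (w : T -> nat -> R) (th : T -> R).
Hypothesis w0 : forall j k, 0 <= w j k.

(* [o t] is the agent who receives position [t]. *)
Definition serves (Q : {set T}) (x y : nat) : Prop :=
  exists (o : nat -> T) (lo hi : T -> nat),
    (forall t, (x <= t < y)%N -> o t \in Q) /\
    forall j, j \in Q -> [/\ (x <= lo j <= hi j)%N, (hi j <= y)%N,
      th j <= span_sum (w j) (lo j) (hi j) &
      forall t, (x <= t < y)%N -> (o t == j) = (lo j <= t < hi j)%N].

Lemma serves1 i x y : (x <= y)%N -> th i <= span_sum (w i) x y ->
  serves [set i] x y.
Proof.
move=> xy thi; exists (fun=> i), (fun=> x), (fun=> y); split.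
  by move=> t _; rewrite inE.
by move=> j /set1P ->; split=> //; [lia | move=> t ->; rewrite eqxx].
Qed.

Lemma serves_cons (Q : {set T}) i x z y : i \in Q -> (x <= z <= y)%N ->
  th i <= span_sum (w i) x z -> serves (Q :\ i) z y -> serves Q x y.
Proof.
move=> iQ xzy thi [o [lo [hi [oQ oP]]]].
exists (fun t => if (t < z)%N then i else o t).
exists (fun j => if j == i then x else lo j).
exists (fun j => if j == i then z else hi j); split.
  move=> t xty; case: ifP => // tz.
  by have /setD1P[] : o t \in Q :\ i by apply: oQ; lia.
move=> j jQ; case: eqVneq => [->|ji].
  split=> //; try lia; move=> t xty; case: ifP => tz; first by rewrite eqxx; lia.
  have /setD1P[/negPf-> _] : o t \in Q :\ i by apply: oQ; lia.
  by lia.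
have jQ' : j \in Q :\ i by rewrite !inE ji.
have [H1 H2 H3 H4] := oP j jQ'; split=> //; try lia.
move=> t xty; case: ifP => tz; last by apply: H4; lia.
by rewrite eq_sym (negPf ji); lia.
Qed.

Lemma first_liked (Q : {set T}) x y : (x <= y)%N ->
  (exists2 j, j \in Q & th j <= span_sum (w j) x y) ->
  exists z, [/\ (x <= z <= y)%N,
    exists2 j, j \in Q & th j <= span_sum (w j) x z &
    forall j t, j \in Q -> (x <= t < z)%N -> span_sum (w j) x t < th j].
Proof.
move=> xy [j jQ jl].
pose Z z := (x <= z)%N && [exists j in Q, th j <= span_sum (w j) x z].
have Zy : Z y by rewrite /Z xy; apply/existsP; exists j; rewrite jQ.
have Zx : exists z, Z z by exists y.
case: (ex_minnP Zx) => z /andP[xz /existsP[i /andP[iQ il]]] zmin.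
exists z; split; [by rewrite xz zmin | by exists i |].
move=> k t kQ /andP[xt tz]; rewrite ltNge; apply/negP => kl.
suff : (z <= t)%N by lia.
by apply: zmin; rewrite /Z xt; apply/existsP; exists k; rewrite kQ.
Qed.

(* The bad agents have priority, so an agent outside [bad] only receives a
   bundle that no bad agent likes; a bundle costs a bad agent who does not get
   it at most one threshold in that case, and two (the bundle minus its last
   good, and that good) otherwise. *)
Lemma priority_taker (Q bad : {set T}) x z : (x <= z)%N ->
  (forall j k, j \in bad -> w j k <= th j) ->
  (exists2 j, j \in Q & th j <= span_sum (w j) x z) ->
  (forall j t, j \in Q -> (x <= t < z)%N -> span_sum (w j) x t < th j) ->
  exists i, [/\ i \in Q, th i <= span_sum (w i) x z &
    forall j, j \in Q -> j \in bad ->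
      span_sum (w j) x z <= (i \in bad).+1%:R * th j].
Proof.
move=> xz wb [i0 i0Q i0l] small.
case: (pickP [pred j | [&& j \in Q, j \in bad & th j <= span_sum (w j) x z]]).
  move=> i /and3P[iQ ib il]; exists i; split=> // j jQ jb.
  rewrite (_ : nat_of_bool (i \in bad) = 1%N) ?ib //.
  case: (ltngtP x z) xz => // [xz _|<- _]; last first.
    rewrite span_sum_id mulr_ge0 //; exact: le_trans (w0 j 0%N) (wb _ _ _).
  case: z xz small il i0l => // z xz small _ _; rewrite span_sumS //.
  have := small j z jQ; rewrite ltnSn andbT => /(_ xz); have := wb j z jb; lra.
move=> none; exists i0; split=> // j jQ jb.
have := none j; rewrite /= jQ jb /= => /negbT; rewrite -ltNge => jl.
apply: (le_trans (ltW jl)); rewrite ler_peMl ?ler1n //.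
exact: le_trans (w0 j 0%N) (wb _ _ _).
Qed.

(** The coefficient [k + #|Q :&: bad|] is a budget: each round lowers it by one if the recipient is
    good and by two if bad, which by [priority_taker] covers the loss of every remaining bad agent.
    A good agent loses at most one interval of her packing per round. *)
Lemma knife (bad : {set T}) y k (Q : {set T}) x :
  (forall j k, j \in bad -> w j k <= th j) ->
  #|Q| = k.+1 -> (x <= y)%N ->
  (forall j, j \in Q -> j \notin bad -> fits (w j) (th j) k.+1 x y) ->
  (forall j, j \in Q -> j \in bad ->
     (k + #|Q :&: bad|)%:R * th j <= span_sum (w j) x y) ->
  serves Q x y.
Proof.
move=> wb; elim: k Q x => [|k IH] Q x cQ xy fgood fbad.
  have /cards1P[i QE] : #|Q| == 1%N by rewrite cQ.
  rewrite QE; apply: serves1 => //.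
  have iQ : i \in Q by rewrite QE inE.
  case: (boolP (i \in bad)) => ib.
    apply: le_trans (fbad i iQ ib); rewrite add0n ler_peMl ?ler1n //.
      exact: le_trans (w0 i 0%N) (wb _ _ _).
    by apply/card_gt0P; exists i; rewrite inE iQ ib.
  have [z [xzy vz _]] := fgood i iQ ib.
  by apply: le_trans vz (span_sum_mono _ _ _ _); try lia.
have liked j : j \in Q -> th j <= span_sum (w j) x y.
  move=> jQ; case: (boolP (j \in bad)) => jb.
    apply: le_trans (fbad j jQ jb); rewrite ler_peMl ?ler1n //.
    exact: le_trans (w0 j 0%N) (wb _ _ _).
  have [z [xzy vz _]] := fgood j jQ jb.
  by apply: le_trans vz (span_sum_mono _ _ _ _); try lia.
have [j0 j0Q] : exists j, j \in Q by apply/card_gt0P; rewrite cQ.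
have [|z [xzy lz small]] := @first_liked Q x y xy.
  by exists j0; rewrite ?liked.
have [xz zy] := andP xzy.
have [i [iQ il ibad]] := priority_taker xz wb lz small.
apply: (serves_cons iQ xzy il).
have cQ' : #|Q :\ i| = k.+1 by move: cQ; rewrite (cardsD1 i) iQ add1n => -[].
apply: IH => //.
- move=> j /setD1P[ji jQ] jb.
  have [z0 [xz0 vz0 fz0]] := fgood j jQ jb.
  (* The knife stops at the first liked prefix, hence no later than the end of the first interval
     that [j] has packed; her other intervals remain intact. *)
  have zz0 : (z <= z0)%N.
    rewrite leqNgt; apply/negP => z0z.
    by have := small j z0 jQ; rewrite ltNge vz0; lia.
  exact: (@fits_start R (w j) (th j) k.+1 z0 z y (w0 j) zz0 fz0).
- move=> j /setD1P[ji jQ] jb.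
  have := fbad j jQ jb; rewrite (@span_sumD _ (w j) x z y) //.
  have -> : #|Q :&: bad| = ((i \in bad) + #|(Q :\ i) :&: bad|)%N.
    by rewrite (cardsD1 i) inE iQ /= setIDAC.
  have := ibad j jQ jb.
  rewrite (_ : (k.+1 + _)%N = (i \in bad).+1 + (k + #|(Q :\ i) :&: bad|))%N; last lia.
  rewrite natrD mulrDl; lra.
Qed.
End Knife.

(** * The cycle unrolled onto the natural numbers *)

Section Unfolding.
Set Implicit Arguments. Unset Strict Implicit.
Variable m' : nat.
Local Notation m := m'.+1.
Local Notation gd k := (inZp k : 'I_m).

Lemma inZp_eq k l : (gd k == gd l) = (k == l %[mod m])%N.
Proof. by rewrite -val_eqE. Qed.

Lemma inZpDm k : gd (k + m) = gd k.
Proof. by apply: val_inj; rewrite /= modnDr. Qed.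

Lemma inZpDl a k l : (gd (a + k) == gd (a + l)) = (gd k == gd l).
Proof. by rewrite !inZp_eq eqn_modDl. Qed.

Lemma inZpS k l : (gd k.+1 == gd l.+1) = (gd k == gd l).
Proof. by rewrite -(inZpDl 1 k l) !add1n. Qed.

Lemma inZp_inj_window x k l : (x <= k < x + m)%N -> (x <= l < x + m)%N ->
  gd k = gd l -> k = l.
Proof.
move=> kx lx /eqP.
have -> : k = (x + (k - x))%N by lia.
have -> : l = (x + (l - x))%N by lia.
by rewrite inZpDl inZp_eq !modn_small; lia.
Qed.

(** Shifting the window by one drops position [x] and gains [x + m], which is the same good. *)
Lemma big_window (T : Type) (idx : T) (op : Monoid.com_law idx)
    (F : 'I_m -> T) x :
  \big[op/idx]_(x <= k < x + m) F (gd k) = \big[op/idx]_g F g.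
Proof.
elim: x => [|x IH]; first
  by rewrite big_mkord; apply: eq_bigr => i _; rewrite valZpK.
rewrite -IH addSn big_nat_recr /=; last lia.
by rewrite [RHS]big_ltn /=; last lia; rewrite inZpDm Monoid.mulmC.
Qed.

Lemma window_repr x (g : 'I_m) : exists2 k, (x <= k < x + m)%N & g = gd k.
Proof.
(* Since [m'] is -1 modulo [m], the offset is the residue of [g - x]. *)
exists (x + (g + x * m') %% m)%N; first
  by have := ltn_pmod (g + x * m') (ltn0Sn m'); lia.
apply: val_inj; rewrite /= modnDmr (_ : (x + _)%N = (x * m + g)%N); last by lia.
by rewrite modnMDl modn_small.
Qed.

Definition cyc_arc x y : {set 'I_m} := [set gd (x + t) | t : 'I_(y - x)].

Lemma cyc_arcP x y g :
  reflect (exists2 k, (x <= k < y)%N & g = gd k) (g \in cyc_arc x y).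
Proof.
apply: (iffP imsetP) => [[t _ ->]|[k kxy ->]].
  by exists (x + t)%N => //; have := ltn_ord t; lia.
have kx : (k - x < y - x)%N by lia.
by exists (Ordinal kx) => //=; rewrite subnKC //; lia.
Qed.

Lemma util_arc (R : realFieldType) (u : 'I_m -> R) x y : (y <= x + m)%N ->
  util u (cyc_arc x y) = span_sum (fun k => u (gd k)) x y.
Proof.
move=> yx; rewrite /util /cyc_arc big_imset /=; last first.
  move=> s t _ _ /(@inZp_inj_window x) H; apply: val_inj => /=.
  by have := ltn_ord s; have := ltn_ord t; lia.
rewrite /span_sum -[in RHS](add0n x) big_addn big_mkord.
by apply: eq_big => [i|i _]; rewrite ?inE // addnC.
Qed.

Lemma util_subset (R : realFieldType) (u : 'I_m -> R) (A B : {set 'I_m}) :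
  (forall g, 0 <= u g) -> A \subset B -> util u A <= util u B.
Proof.
move=> u0 /subsetP AB; rewrite /util big_mkcond [leRHS]big_mkcond ler_sum // => g _.
by case: ifP => [/AB->//|_]; case: ifP.
Qed.

Lemma cyc_adj_sym (i j : 'I_m) : cyc_adj i j = cyc_adj j i.
Proof. by rewrite /cyc_adj orbC. Qed.

Lemma cyc_adjS k : cyc_adj (gd k) (gd k.+1).
Proof. by rewrite /cyc_adj /= -[in X in _ == X]addn1 modnDml addn1 eqxx. Qed.

Lemma cyc_adjP (i j : 'I_m) :
  reflect (exists k, (i = gd k /\ j = gd k.+1) \/ (i = gd k.+1 /\ j = gd k))
          (cyc_adj i j).
Proof.
apply: (iffP orP) => [[] /eqP H|].
- by exists i; left; rewrite valZpK; split=> //; apply: val_inj.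
- by exists j; right; rewrite valZpK; split=> //; apply: val_inj.
- case=> k [] [-> ->]; apply/orP; first exact: cyc_adjS.
  by have := cyc_adjS k; rewrite cyc_adj_sym.
Qed.

Lemma connected_arc x y : connected_bundle (cyc_arc x y).
Proof.
rewrite /connected_bundle; set e := [rel _ _ | _]; have eC : connect_sym e.
  apply: sym_connect_sym => {}a {}b /=.
  by rewrite cyc_adj_sym andbCA.
have up k l : (x <= k)%N -> (k <= l < y)%N -> connect e (gd k) (gd l).
  elim: l => [|l IH] xk kl; first by rewrite (_ : k = 0%N) ?connect0; lia.
  have [->|kNl] := eqVneq k l.+1; first exact: connect0.
  apply: connect_trans (IH xk _) _; first lia.
  apply: connect1; rewrite /= cyc_adjS andbT.
  by apply/andP; split; apply/cyc_arcP; [exists l | exists l.+1] => //; lia.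
apply/forall_inP => a /cyc_arcP[k kxy ->]; apply/forall_inP => b /cyc_arcP[l lxy ->].
by case: (leqP k l) => kl; [|rewrite eC]; apply: up; lia.
Qed.

End Unfolding.

(** * The cuts of one split of the cycle *)

Section Cuts.
Set Implicit Arguments. Unset Strict Implicit.
Variables m' n : nat.
Local Notation m := m'.+1.
Local Notation gd k := (inZp k : 'I_m).
Variable o : 'I_m -> 'I_n.+2.
Hypothesis o_conn : forall i, connected_bundle [set g | o g == i].
Hypothesis o_surj : forall i, exists g, o g = i.

(** Adding [m'] modulo [m] steps back to the predecessor. A cut at [k] thus lies between the
    positions [k - 1] and [k]. *)
Definition start (g : 'I_m) : bool := o g != o (gd (g + m')).
Definition cut (k : nat) : bool := start (gd k).

Lemma cutS k : cut k.+1 = (o (gd k.+1) != o (gd k)).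
Proof.
rewrite /cut /start (_ : gd (gd k.+1 + m') = gd k) //.
by apply/eqP; rewrite inZp_eq /= modnDml addSnnS modnDr.
Qed.

(** Follow a path from [g] to [g'] inside the bundle. Each good on it is reached from [g] by going
    forward within the bundle ([run]), since a step back from [g] itself would leave it. If [g'] is
    reached after a positive number of steps, its predecessor is in the bundle, so [g'] is no
    start. *)
Lemma start_inj g g' : start g -> start g' -> o g = o g' -> g = g'.
Proof.
move=> sg sg' ogg'.
have /forall_inP/(_ g) := o_conn (o g); rewrite inE eqxx => /(_ isT).
move/forall_inP/(_ g'); rewrite inE ogg' eqxx => /(_ isT).
case/connectP => p; rewrite -ogg' => ep lastp.
pose run h t := h = gd (g + t) /\ forall s, (s <= t)%N -> o (gd (g + s)) = o g.
have run_g : exists t, run g t.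
  exists 0%N; split; first by rewrite addn0 valZpK.
  by move=> s; rewrite leqn0 => /eqP->; rewrite addn0 valZpK.
have [t [gt ot]] : exists t, run g' t.
  move: ep run_g; rewrite {}lastp; set e := (X in path X).
  suff claim a : path e a p -> (exists t, run a t) -> exists t, run (last a p) t.
    exact: claim.
  elim: p a => //= h p IH a /andP[ea ep] [t [at_ ot]].
  move: ea; rewrite /e /= !inE => /and3P[_ /eqP oh /cyc_adjP[k [] [ak hk]]].
  - apply: IH => //; exists t.+1; split.
      rewrite hk; apply/eqP; by rewrite addnS inZpS -ak at_.
    move=> s; rewrite leq_eqVlt => /orP[/eqP->|]; last exact: ot.
    rewrite -oh hk; congr o; apply/eqP.
    by rewrite addnS inZpS -ak at_.
  - have ht : gd (g + t) = gd k.+1 by rewrite -at_ ak.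
    case: t at_ ot ht => [|t] at_ ot ht.
      have : cut k.+1 by rewrite /cut -ht addn0 valZpK.
      rewrite cutS -ht -hk oh addn0 valZpK eqxx //.
    apply: IH => //; exists t; split; last by move=> s st; apply: ot; lia.
    rewrite hk; apply/eqP; move/eqP: ht.
    by rewrite addnS inZpS eq_sym.
case: t gt ot => [|t] gt ot; first by rewrite gt addn0 valZpK.
have : cut (g + t).+1 by rewrite /cut -addnS -gt.
by rewrite cutS -addnS !ot ?eqxx.
Qed.

(** If bundle [i] had no start, walking back from one of its goods would never leave it, so it would
    be the whole cycle. *)
Lemma start_surj i : exists2 g, start g & o g = i.
Proof.
case: (pickP [pred g | start g && (o g == i)]) => [g /andP[sg /eqP]|none].
  by exists g.
have [h hi] := o_surj i.
have back t : (t <= h + m)%N -> o (gd (h + m - t)) = i.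
  elim: t => [|t IH] th; first by rewrite subn0 inZpDm valZpK.
  have := none (gd (h + m - t)); rewrite /= IH ?eqxx ?andbT; last lia.
  rewrite -[start _]/(cut (h + m - t)).
  rewrite (_ : (h + m - t)%N = (h + m - t.+1).+1); last lia.
  move/negbT; rewrite cutS negbK => /eqP<-.
  rewrite (_ : (h + m - t.+1).+1 = (h + m - t)%N); last lia.
  by rewrite IH //; lia.
(* There are at least two bundles, and the other one is nonempty too. *)
have [j ji] : exists j : 'I_n.+2, j != i.
  case: (eqVneq ord0 i) => [<-|]; first by exists ord_max.
  by exists ord0.
have [g gj] := o_surj j; have := ltn_ord g => gm.
have := back (h + m - g)%N; rewrite subKn; last lia.
by rewrite valZpK gj => /(_ (leq_subr _ _)) jE; rewrite jE eqxx in ji.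
Qed.

(** [o] maps the starts bijectively onto the bundles. *)
Lemma sum_cut x : (\sum_(x <= k < x + m) cut k)%N = n.+2.
Proof.
rewrite (big_window addn (fun g => nat_of_bool (start g))).
rewrite -big_mkcond sum1_card -[RHS](card_ord n.+2) -(card_in_image (f := o)).
  apply: eq_card => i; rewrite [RHS]inE.
  by have [g sg <-] := start_surj i; rewrite image_f.
by move=> g g'; apply: start_inj.
Qed.

Lemma next_cut x y : (0 < \sum_(x <= p < y) cut p)%N ->
  exists z, [/\ (x <= z < y)%N, cut z, forall p, (x <= p < z)%N -> ~~ cut p &
    (\sum_(x <= p < y) cut p = (\sum_(z.+1 <= p < y) cut p).+1)%N].
Proof.
move=> pos.
have ex : exists z, (x <= z)%N && cut z.
  case: (pickP [pred z : 'I_y | (x <= z)%N && cut z]) => [z|none].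
    by exists z.
  move: pos; rewrite big_nat big1 // => p /andP[xp py].
  by have := none (Ordinal py); rewrite /= xp => /= ->.
case: (ex_minnP ex) => z /andP[xz cz] zmin.
have nocut p : (x <= p < z)%N -> ~~ cut p.
  move=> xpz; apply/negP => cp; have := zmin p; rewrite cp andbT; lia.
have zy : (z < y)%N.
  rewrite ltnNge; apply/negP => yz; move: pos; rewrite big_nat big1 // => p xpy.
  by rewrite (negPf (nocut p _)) //; lia.
exists z; split=> //; first by rewrite xz.
rewrite (@big_cat_nat _ _ _ z) //=; try lia.
rewrite big_nat big1 => [|p xpz]; first by rewrite big_ltn // cz.
by rewrite (negPf (nocut p _)).
Qed.

(** Beyond [z] the bundle of [x] could be entered again only at a start of it, and by [start_inj]
    its only start is [x]. *)
Lemma bundle_sub_arc x z : cut x -> cut z -> (x < z <= x + m)%N ->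
  (forall p, (x < p < z)%N -> ~~ cut p) ->
  [set g | o g == o (gd x)] \subset cyc_arc m' x z.
Proof.
move=> cx cz xz nocut.
have inner k : (x <= k < z)%N -> o (gd k) = o (gd x).
  elim: k => [|k IH] xk; first by rewrite (_ : x = 0%N) //; lia.
  case: (eqVneq x k.+1) => [->//|xNk].
  have := nocut k.+1; rewrite cutS negbK => /(_ _)/eqP -> //; last lia.
  by apply: IH; lia.
have outer k : (z <= k < x + m)%N -> o (gd k) != o (gd x).
  elim: k => [|k IH] zk; first by lia.
  case: (boolP (cut k.+1)) => ck.
    apply/eqP => /(start_inj ck cx) E.
    by have := @inZp_inj_window m' x k.+1 x _ _ E; lia.
  have zNk : z != k.+1 by apply: contraNneq ck => <-.
  by move: ck; rewrite cutS negbK => /eqP->; apply: IH; lia.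
apply/subsetP => g; rewrite inE => og; apply/cyc_arcP.
have [k kx gk] := window_repr x g; exists k => //.
rewrite gk in og; have := outer k; rewrite og; lia.
Qed.

Section Fits.
Variables (R : realFieldType) (u : 'I_m -> R) (v : R).
Hypothesis u0 : forall g, 0 <= u g.
Hypothesis uv : forall i, v <= util u [set g | o g == i].
Local Notation w := (fun k => u (gd k)).

(** Hop from cut to cut: each hop covers a whole bundle. The sum runs up to [y] inclusive, since a
    cut at [y] closes the last bundle. *)
Lemma fits_from_cut k x y : cut x -> (x <= y <= x + m)%N ->
  (k <= \sum_(x.+1 <= p < y.+1) cut p)%N -> fits w v k x y.
Proof.
elim: k x => [|k IH] x cx xy; first by move=> _ /=; lia.
move=> kle.
have [z [xzy cz nocut sumE]] := next_cut (leq_trans (ltn0Sn k) kle).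
exists z; split; first by lia.
  rewrite -util_arc; last lia.
  apply: le_trans (uv (o (gd x))) _.
  by apply: util_subset => //; apply: bundle_sub_arc => //; lia.
by apply: IH => //; lia.
Qed.

(** No cut lies strictly between [a] and [b], so the closed range from [b] to [a + m] sees all
    [n.+2] cuts. The first one opens the packing and the other [n.+1] each close a bundle. *)
Lemma fits_outside a b : (a <= b <= a + m)%N ->
  (forall p, (a < p < b)%N -> ~~ cut p) -> fits w v n.+1 b (a + m).
Proof.
move=> ab nocut.
have cnt : (n.+2 <= \sum_(b <= p < (a + m).+1) cut p)%N.
  rewrite -(sum_cut b); have [->|aNb] := eqVneq a b.
    by rewrite [X in (_ <= X)%N]big_nat_recr /= ?leq_addr //; lia.
  have tail0 : (\sum_((a + m).+1 <= p < b + m) cut p = 0)%N.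
    rewrite big_nat big1 // => p apb.
    rewrite (_ : p = (p - m + m)%N); last lia.
    by rewrite /cut inZpDm -/(cut (p - m)) (negPf (nocut _ _)) //; lia.
  by rewrite (@big_cat_nat _ _ _ (a + m).+1 b (b + m)) /= ?tail0 ?addn0 //; lia.
have [x [bxy cx _ sumE]] := next_cut (leq_trans (ltn0Sn _) cnt).
apply: (@fits_start R w v n.+1 x b) => //; first by lia.
apply: fits_from_cut => //; first by lia.
by rewrite -ltnS -sumE.
Qed.
End Fits.
End Cuts.

(** * Maximin shares and the cuts of an optimal split *)

Section Mms.
Set Implicit Arguments. Unset Strict Implicit.
Variable R : realFieldType.

Lemma split_owner m n (P : {ffun 'I_n -> {set 'I_m}}) : is_split P ->
  exists o : 'I_m -> 'I_n, forall i, P i = [set g | o g == i].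
Proof.
case/and3P=> _ /forallP dis /eqP cov.
have ex g : exists i, g \in P i.
  have : g \in \bigcup_(i < n) P i by rewrite cov inE.
  by case/bigcupP => i _; exists i.
exists (fun g => xchoose (ex g)) => i; apply/setP => g; rewrite inE.
have gP := xchooseP (ex g).
apply/idP/eqP => [gi|<- //]; apply/eqP; apply: contraLR (gi) => ne.
have /forallP/(_ i)/implyP/(_ ne) := dis (xchoose (ex g)).
by move/pred0P/(_ g); rewrite /= gP => /= ->.
Qed.

Lemma split_value_le m n (u : 'I_m -> R) (P : {ffun 'I_n -> {set 'I_m}}) i :
  split_value u P <= util u (P i).
Proof. by rewrite /split_value; apply: bigmin_le_cond. Qed.

Lemma mms_ge0 m n (u : 'I_m -> R) : 0 <= mms n u.
Proof. exact: bigmax_ge_id. Qed.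

(** The alternative 0 is the default value of the big maximum. *)
Lemma mms_attained m n (u : 'I_m -> R) : mms n u = 0 \/
  exists2 P : {ffun 'I_n -> {set 'I_m}}, is_split P &
    forall i, mms n u <= util u (P i).
Proof.
pose K (x : R) := x = 0 \/
  exists2 P : {ffun 'I_n -> {set 'I_m}}, is_split P & x = split_value u P.
have [->|[P sP ->]] : K (mms n u).
- rewrite /mms; apply: big_ind => [|x y Kx Ky|P sP]; first by left.
    by rewrite /Order.max; case: ifP.
  by right; exists P.
- by left.
by right; exists P => // i; exact: split_value_le.
Qed.

Lemma mms_total m n (u : 'I_m -> R) : (forall g, 0 <= u g) ->
  n%:R * mms n u <= util u setT.
Proof.
move=> u0; have [->|[P sP le_mms]] := mms_attained n u.
  by rewrite mulr0 sumr_ge0.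
have [o oP] := split_owner sP.
rewrite /util (partition_big o predT) //= mulr_natl.
rewrite (_ : _ *+ n = \sum_(i < n) mms n u); last by rewrite sumr_const card_ord.
apply: ler_sum => i _.
apply: le_trans (le_mms i) _; rewrite oP /util.
by rewrite le_eqVlt; apply/orP; left; apply/eqP; apply: eq_bigl => g; rewrite !inE.
Qed.

(** For a zero share, no cuts are needed, as empty intervals already form the packing. For a
    positive share, all bundles of an optimal split are nonempty, so its cuts can be used. *)
Lemma agent_cuts m' n (u : 'I_m'.+1 -> R) : (forall g, 0 <= u g) ->
  exists C : nat -> bool,
    (forall x, (\sum_(x <= k < x + m'.+1) C k <= n.+2)%N) /\
    (forall a b, (a <= b <= a + m'.+1)%N ->
       (forall p, (a < p < b)%N -> ~~ C p) ->
       fits (fun k => u (inZp k)) (mms n.+2 u) n.+1 b (a + m'.+1)).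
Proof.
move=> u0; case: (eqVneq (mms n.+2 u) 0) => [->|mms0].
  exists (fun=> false); split=> [x|a b ab _]; first by rewrite big1.
  by apply: fits0 => //; lia.
have [/eqP|[P sP le_mms]] := mms_attained n.+2 u; first by rewrite (negPf mms0).
have [o oP] := split_owner sP.
have o_conn i : connected_bundle [set g | o g == i].
  by rewrite -oP; case/and3P: sP => /forallP.
have o_surj i : exists g, o g = i.
  case: (pickP [pred g | o g == i]) => [g /eqP|none]; first by exists g.
  have := le_mms i; rewrite oP /util big_pred0 => [|g]; last by rewrite inE; exact: none g.
  by rewrite le_eqVlt (negPf mms0) ltNge mms_ge0.
exists (cut o); split=> [x|a b ab nocut]; first by rewrite sum_cut.
apply: (fits_outside o_conn o_surj) => // i.
by rewrite -oP.
Qed.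

End Mms.

(** * Choosing the first arc and dividing the rest of the cycle *)

Section CyclicDivision.
Set Implicit Arguments. Unset Strict Implicit.
Variables (R : realFieldType) (m n : nat).
Local Notation T := 'I_n.+2.
Variables (w : T -> nat -> R) (v : T -> R) (C : T -> nat -> bool) (c : R).
Variables s d : nat.
Hypothesis m0 : (0 < m)%N.
Hypothesis w0 : forall j k, 0 <= w j k.
Hypothesis w_mod : forall j k, w j (k %% m) = w j k.
Hypothesis v0 : forall j, 0 <= v j.
Hypothesis C_count : forall j x, (\sum_(x <= k < x + m) C j k <= n.+2)%N.
Hypothesis C_fits : forall j a b, (a <= b <= a + m)%N ->
  (forall p, (a < p < b)%N -> ~~ C j p) -> fits (w j) (v j) n.+1 b (a + m).
Hypothesis total : forall j x, n.+2%:R * v j <= span_sum (w j) x (x + m).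
Hypothesis c0 : 0 <= c.
Hypothesis cd : c * d%:R <= n.+2%:R.
Hypothesis cs : c * (n + s)%:R <= n.+2%:R.
Hypothesis dn : (n.+2 <= d)%N.
Hypothesis ds : (n.+2 ^ 2 <= d * s)%N.
Local Notation th := (fun j => c * v j).

Lemma c_le1 : c <= 1.
Proof.
have n0 : 0 < n.+2%:R :> R by rewrite ltr0n.
rewrite -(ler_pM2r n0) mul1r; apply: le_trans cd.
by rewrite ler_wpM2l // ler_nat.
Qed.

Lemma C_fits_th j a b : (a <= b <= a + m)%N ->
  (forall p, (a < p < b)%N -> ~~ C j p) -> fits (w j) (th j) n.+1 b (a + m).
Proof.
move=> ab nc; apply: fits_le (C_fits ab nc).
by rewrite ler_piMl // c_le1.
Qed.

Lemma serves_after (bad : {set T}) a z i : (a <= z <= a + m)%N ->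
  th i <= span_sum (w i) a z ->
  (forall j k, j \in bad -> w j k <= th j) ->
  (forall j, j != i -> j \notin bad -> fits (w j) (th j) n.+1 z (a + m)) ->
  (forall j, j != i -> j \in bad ->
     (n + #|bad :\ i|)%:R * th j <= span_sum (w j) z (a + m)) ->
  serves w th setT a (a + m).
Proof.
move=> az il wb fgood fbad; apply: (serves_cons (in_setT i) az il).
apply: (@knife R T w th w0 bad (a + m) n) => //.
- by have := cardsD1 i [set: T]; rewrite inE cardsT card_ord add1n => -[].
- by lia.
- by move=> j; rewrite !inE andbT => ji; apply: fgood.
- move=> j; rewrite !inE andbT => ji jb.
  rewrite (_ : (setT :\ i) :&: bad = bad :\ i); first exact: fbad.
  by rewrite setDE setTI setIC -setDE.
Qed.

(** The strict bound comes from opening the cycle at a position where someone has a cut: that cut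
    becomes an endpoint and is no longer counted. *)
Lemma light_window : exists x,
  (\sum_(x.+1 <= k < x + m) \sum_(j : T) C j k < n.+2 ^ 2)%N.
Proof.
have bound x : (\sum_(x <= k < x + m) \sum_(j : T) C j k <= n.+2 ^ 2)%N.
  rewrite exchange_big /=; apply: (@leq_trans (\sum_(j : T) n.+2)%N).
    by apply: leq_sum => j _; exact: C_count.
  by rewrite sum_nat_const card_ord expnS expn1.
have step x : (\sum_(x <= k < x + m) \sum_(j : T) C j k =
  \sum_(j : T) C j x + \sum_(x.+1 <= k < x + m) \sum_(j : T) C j k)%N.
  by rewrite big_ltn //; lia.
case: (posnP (\sum_(0.+1 <= k < 0 + m) \sum_(j : T) C j k)%N) => [E|].
  by exists 0%N; rewrite E expn_gt0.
rewrite lt0n sum_nat_seq_neq0 => /hasP[x _ /= Cx]; exists x.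
by apply: leq_trans (bound x); rewrite step -add1n leq_add2r lt0n.
Qed.

Lemma cyclic_serves : exists a, serves w th setT a (a + m).
Proof.
(* A single liked good is an arc without interior, so nobody has a cut inside it and the bad set is
   empty. *)
case: (boolP [exists x : 'I_m, exists i : T, th i <= w i x]).
  case/existsP=> a /existsP[i il]; exists a.
  apply: (@serves_after set0 a a.+1 i); rewrite ?span_sumS ?span_sum_id ?add0r //.
  - by lia.
  - by move=> j k; rewrite inE.
  - by move=> j _ _; apply: C_fits_th => [|p]; lia.
  - by move=> j _; rewrite inE.
move=> small_good.
have w_small j k : w j k <= th j.
  rewrite ltW // ltNge; apply: contra small_good => lk.
  apply/existsP; exists (Ordinal (ltn_pmod k m0)).
  by apply/existsP; exists j; rewrite /= w_mod.
have [x light] := light_window.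
have s0 : (0 < s)%N by move: ds; case: (s) => //; rewrite muln0 leqn0 expn_eq0.
(* Any agent can be used to find the light arc; [ord0] is an arbitrary choice. She values the cycle
   at [d] thresholds because [c * d <= n.+2]. *)
have [||a [b [xa bx hab lab]]] := @light_span R (w ord0)
    (fun k => \sum_(j : T) C j k)%N s d (th ord0) x (x + m) (w0 ord0) s0 (leq_addr _ _).
- exact: leq_trans light ds.
- apply: le_trans (total ord0 x); rewrite mulrA; apply: ler_wpM2r => //.
  by rewrite mulrC.
have [||z [az [i0 i0T i0l] small]] := @first_liked R T w th setT a b.
- by case/andP: xa.
- by exists ord0; rewrite ?inE.
have [az1 zb] := andP az.
pose bad := [set j : T | (0 < \sum_(a.+1 <= k < z) C j k)%N].
have card_bad : (#|bad| < s)%N.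
  apply: leq_ltn_trans hab; rewrite exchange_big /= -sum1_card.
  rewrite [leqLHS]big_mkcond leq_sum // => j _; rewrite inE; case: ifP => // pos.
  have az2 : (a < z)%N by rewrite ltnNge; apply: contraL pos => za; rewrite big_geq //; lia.
  by rewrite (@big_cat_nat _ _ _ z) //= (leq_trans pos) ?leq_addr.
have [i [_ il ibad]] := @priority_taker R T w th w0 setT bad a z az1
  (fun j k _ => w_small j k) (ex_intro2 _ _ i0 i0T i0l) small.
exists a; apply: (@serves_after bad a z i) => //; first by lia.
- move=> j _ jb; apply: C_fits_th; first lia.
  move=> p apz; move: jb; rewrite inE lt0n negbK sum_nat_seq_eq0.
  by move/allP/(_ p); rewrite mem_index_iota /= apz eqb0 => /(_ isT).
move=> j _ jb; have := total j a; rewrite (@span_sumD R (w j) a z); last lia.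
have := ibad j (in_setT _) jb.
(* The first arc costs [j] at most [(i \in bad).+1] thresholds and the knife needs
   [n + #|bad :\ i|]; together this is [n + 1 + #|bad|], at most [n + s]. *)
have : (n + (i \in bad).+1 + #|bad :\ i|)%:R * th j <= n.+2%:R * v j.
  apply: le_trans (_ : (n + s)%:R * th j <= _).
    by apply: ler_wpM2r; rewrite ?mulr_ge0 // ler_nat -addnA leq_add2l addSn -cardsD1.
  by rewrite mulrA [_ * c]mulrC ler_wpM2r.
rewrite !natrD !mulrDl; lra.
Qed.
End CyclicDivision.

(** * From intervals back to bundles, and the final choice of constants *)

Section Allocation.
Set Implicit Arguments. Unset Strict Implicit.

Lemma serves_allocation (R : realFieldType) m' n (u : 'I_n -> 'I_m'.+1 -> R)
    (th : 'I_n -> R) a :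
  serves (fun j k => u j (inZp k)) th setT a (a + m'.+1) ->
  exists P : {ffun 'I_n -> {set 'I_m'.+1}},
    is_split P /\ forall j, th j <= util (u j) (P j).
Proof.
case=> o [lo [hi [_ oP]]].
exists [ffun j => cyc_arc m' (lo j) (hi j)]; split=> [|j]; last first.
  have [H1 H2 H3 _] := oP j (in_setT j); rewrite ffunE util_arc //; lia.
apply/and3P; split.
- by apply/forallP => j; rewrite ffunE connected_arc.
- apply/forallP => i; apply/forallP => j; apply/implyP => ij; rewrite !ffunE.
  apply/pred0P => g /=; apply: contraNF ij => /andP[/cyc_arcP[k ki gk] /cyc_arcP[l lj gl]].
  have [H1 H2 _ oi] := oP i (in_setT i); have [H1' H2' _ oj] := oP j (in_setT j).
  have kl : k = l.
    by apply: (@inZp_inj_window m' a); [lia | lia | rewrite -gk gl].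
  have /eqP <- : o k == i by rewrite oi //; lia.
  by rewrite oj kl //; lia.
- apply/eqP/setP => g; rewrite inE; apply/bigcupP.
  have [k ka ->] := window_repr a g; exists (o k) => //.
  have [_ _ _ oj] := oP (o k) (in_setT _).
  by rewrite ffunE; apply/cyc_arcP; exists k => //; rewrite -oj.
Qed.

End Allocation.

Lemma ceil_div_mul a b : (0 < b)%N -> (a <= b * ceil_div a b)%N.
Proof.
move=> b0; have := ltn_ceil (a + b).-1 b0; rewrite mulSn mulnC /ceil_div; lia.
Qed.

Theorem theorem4p4 (R : realFieldType) (m n : nat) (U : 'I_n -> 'I_m -> R)
    (c : R) :
  (2 <= n)%N ->
  (forall (i : 'I_n) (g : 'I_m), 0 <= U i g) ->
  (* c = max_{d >= n} cval n d *)
  (exists2 d : nat, (n <= d)%N & c = cval R n d) ->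
  (forall d : nat, (n <= d)%N -> cval R n d <= c) ->
  exists P : {ffun 'I_n -> {set 'I_m}}, c_sufficient U c P.
Proof.
case: n U => [|[|n]] // U _ U0 [d nd cE] _.
have d0 : (0 < d)%N by lia.
set s := ceil_div (n.+2 ^ 2) d.
have ds : (n.+2 ^ 2 <= d * s)%N by exact: ceil_div_mul.
have s0 : (0 < s)%N by move: ds; case: (s) => //; rewrite muln0 leqn0 expn_eq0.
(* The number of agents is now [n.+2], so the second denominator of [cval] becomes [n + s]. *)
have qE : (ceil_div (n.+2 ^ 2) d + n.+2 - 2 = n + s)%N by rewrite -/s; lia.
have c0 : 0 <= c by rewrite cE /cval le_min !divr_ge0 ?ler0n.
have cd : c * d%:R <= n.+2%:R.
  by rewrite -ler_pdivlMr ?ltr0n // cE /cval ge_min lexx.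
have cs : c * (n + s)%:R <= n.+2%:R.
  by rewrite -ler_pdivlMr ?ltr0n ?addn_gt0 ?s0 ?orbT // cE /cval qE ge_min lexx orbT.
(* Without goods all shares are at most 0 and empty bundles suffice; a positive [m] is needed to
   unroll the cycle. *)
case: m U U0 => [|m'] U U0.
  exists [ffun=> set0]; split=> [|i].
    apply/and3P; split.
    - by apply/forallP => i; apply/forall_inP => -[].
    - by apply/forallP => i; apply/forallP => j; apply/implyP => _; apply/pred0P => -[].
    - by apply/eqP/setP => -[].
  have := mms_total n.+2 (U0 i); rewrite /util !big1 => [|[]//|[]//].
  by rewrite pmulr_rle0 ?ltr0n // => /(mulr_ge0_le0 c0).
have /fin_all_exists[C CP] : forall j, exists C : nat -> bool,
    (forall x, (\sum_(x <= k < x + m'.+1) C k <= n.+2)%N) /\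
    (forall a b, (a <= b <= a + m'.+1)%N ->
       (forall p, (a < p < b)%N -> ~~ C p) ->
       fits (fun k => U j (inZp k)) (mms n.+2 (U j)) n.+1 b (a + m'.+1)).
  by move=> j; apply: agent_cuts.
have [a /serves_allocation[P [sP PP]]] : exists a, serves (fun j k => U j (inZp k))
    (fun j => c * mms n.+2 (U j)) setT a (a + m'.+1).
  apply: (@cyclic_serves R m'.+1 n _ _ C c s d) => //.
  - by move=> j k; congr (U j); apply: val_inj; rewrite /= modn_mod.
  - by move=> j; exact: mms_ge0.
  - by move=> j x; case: (CP j).
  - by move=> j a b; case: (CP j) => _; apply.
  move=> j x; rewrite -util_arc //; apply: le_trans (mms_total _ (U0 j)) _.
  apply: util_subset => //; apply/subsetP => g _; apply/cyc_arcP.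
  by have [k kx ->] := window_repr x g; exists k.
by exists P.
Qed.
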